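(* Let $X$ be a Banach space with dual $X^*$ and let $(x_k)_{k\geq 1}$ be a convex shift-bounded sequence in $X$. Then the following conditions are equivalent: (i) $(x_k)_{k\geq1}$ is weakly mixing to zero, that is $$\lim_{n\to\infty}\frac 1n\sum_{k=1}^n|\langle x^*,x_k\rangle|=0\quad\text{for all }x^*\in X^*.$$ (j) $(x_k)_{k\geq 1}$ is uniformly weakly mixing to zero, that is $$\lim_{n\to\infty}\ \sup\Big\{\frac 1n\sum_{k=1}^n|\langle x^*,x_k\rangle|\ ;\ x^*\in X^*,\ \|x^*\|\leq 1\Big\}=0.$$ (jw) $$\limsup_{a,b\in\mathbb N^*,\ b-a\to\infty}\ \sup\Big\{\frac 1{b-a+1}\sum_{k=a}^b|\langle x^*,x_k\rangle|\ ;\ x^*\in X^*,\ \|x^*\|\leq 1\Big\}=0.$$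
   Context: $\mathbb N^*=\{1,2,\ldots\}$. Banach spaces are real or complex. A sequence $(x_k)_{k\ge1}$ in a Banach space is convex shift-bounded if there exists a constant $c>0$ such that $$\Big\|\sum_{j=1}^p\lambda_j x_{j+k}\Big\|\leq c\,\Big\|\sum_{j=1}^p\lambda_j x_j\Big\|,\qquad k\geq 1,$$ for any choice of $p\in\mathbb N^*$ and real $\lambda_1,\ldots,\lambda_p\geq 0$. *)

(* Defs.v *)
From HB Require Import structures.
From mathcomp Require Export all_boot all_order all_algebra.
From mathcomp Require Export complex.
From mathcomp Require Export all_classical all_reals all_analysis.
Export Order.TTheory GRing.Theory Num.Theory.
Export numFieldNormedType.Exports.

Set Implicit Arguments.
Unset Strict Implicit.
Unset Printing Implicit Defensive.

Local Open Scope classical_set_scope.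
Local Open Scope ring_scope.

(* The scalar field K is meant to be R or R[i].  Library norms over R[i] take
   their values in R[i] (with zero imaginary part), so suprema and limits of
   norms are taken after applying re : K -> R, which is the identity for K = R
   and the real part for K = R[i].

   Sequences (x_k)_{k >= 1} are functions on nat whose value at 0 is never
   used. *)
Section definitions.
Variables (R : realType) (K : numFieldType) (re : K -> R).
Variable X : normedModType K.
Implicit Types (x : nat -> X) (f : {linear X -> K^o}).

(* In R[i] the order satisfies 0 <= z iff z is real and nonnegative, so c and
   the lambda j range over real numbers also when K = R[i]. *)
Definition convex_shift_bounded x : Prop :=
  exists2 c : K, 0 < c &
    forall (p : nat) (lambda : nat -> K) (k : nat),
      (1 <= p)%N -> (1 <= k)%N ->
      (forall j, (1 <= j <= p)%N -> 0 <= lambda j) ->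
      `|\sum_(1 <= j < p.+1) lambda j *: x (j + k)%N| <=
        c * `|\sum_(1 <= j < p.+1) lambda j *: x j|.

Definition dual : set {linear X -> K^o} :=
  [set f | continuous (f : X -> K^o)].

Definition dual_norm f : \bar R :=
  ereal_sup [set (re `|f u|)%:E | u in [set u : X | `|u| <= 1]].

Definition dual_ball : set {linear X -> K^o} :=
  [set f | dual f /\ (dual_norm f <= 1)%E].

Definition mean_abs x f (a b : nat) : R :=
  (b.+1 - a)%:R^-1 * \sum_(a <= k < b.+1) re `|f (x k)|.

Definition sup_mean_abs x (a b : nat) : \bar R :=
  ereal_sup [set (mean_abs x f a b)%:E | f in dual_ball].

Definition weakly_mixing_to_zero x : Prop :=
  forall f, dual f -> mean_abs x f 1 n @[n --> \oo] --> (0 : R).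

Definition uniformly_weakly_mixing_to_zero x : Prop :=
  sup_mean_abs x 1 n @[n --> \oo] --> (0%E : \bar R).

(* The filter "b - a --> oo" on pairs (a, b) of positive integers. *)
Definition gap_to_infinity : set_system (nat * nat) :=
  filter_from [set: nat]
    (fun N => [set ab | [/\ (1 <= ab.1)%N, (1 <= ab.2)%N &
                            (ab.1 + N <= ab.2)%N]]).

Definition windowed_uniformly_weakly_mixing_to_zero x : Prop :=
  limf_esup (fun ab : nat * nat => sup_mean_abs x ab.1 ab.2) gap_to_infinity
  = 0%E.

End definitions.

(* Main.v *)
From HB Require Import structures.
Require Import Defs.
From mathcomp Require Import ring lra zify.

(**
Suppose that the means over long windows are not uniformly small.  After
passing to one of the real functionals Re f, - Re f, Re (i f), - Re (i f), there
are e > 0 and, by greedy covering, for each N a functional h_N <= ||.|| and a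
position m_N such that the set A_N = {k | h_N (x_(m_N + k)) >= e} has at least
delta n elements in [0, n) for all n <= N.  Along an ultrafilter the sets A_N
converge to a set B with at least delta n elements in [0, n) for all n, every
initial segment of which is one of some A_N.  Convex shift-boundedness (with
constant C) then bounds every convex combination of the x_(k + 1), k in B, below
in norm by e / C.  Hahn-Banach yields one functional f with
Re f (x_(k + 1)) >= e / C on B, and f contradicts weak mixing since B has
positive lower density.
*)

Set Implicit Arguments.
Unset Strict Implicit.
Unset Printing Implicit Defensive.

Local Open Scope classical_set_scope.
Local Open Scope ring_scope.

(** * Hahn-Banach theorem for sublinear functionals and convex cones *)

Section hahn_banach.
Variables (R : realType) (K : numFieldType) (iota : {rmorphism R -> K}).
Variable V : lmodType K.
Implicit Types (p q f : V -> R).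

Definition sublinear p : Prop :=
  (forall u v, p (u + v) <= p u + p v) /\
  (forall r v, 0 <= r -> p (iota r *: v) = r * p v).

Definition real_linear f : Prop :=
  (forall u v, f (u + v) = f u + f v) /\
  (forall r v, f (iota r *: v) = r * f v).

Lemma sublinear_of_le p :
  (forall u v, p (u + v) <= p u + p v) -> p 0 = 0 ->
  (forall r v, 0 < r -> p (iota r *: v) <= r * p v) -> sublinear p.
Proof.
move=> pD p0 pZ; split => // r v; rewrite le_eqVlt => /predU1P[<-|r0].
  by rewrite rmorph0 scale0r p0 mul0r.
apply/le_anti/andP; split; first exact: pZ.
have ri0 : 0 < r^-1 by rewrite invr_gt0.
have := pZ _ (iota r *: v) ri0.
by rewrite scalerA -rmorphM mulVf ?gt_eqF// rmorph1 scale1r ler_pdivlMl.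
Qed.

Lemma sublinear0 p : sublinear p -> p 0 = 0.
Proof. by move=> [_ pZ]; rewrite -(scale0r 0) -(rmorph0 iota) pZ// mul0r. Qed.

Lemma sublinear_geN p v : sublinear p -> - p (- v) <= p v.
Proof.
move=> sp; have [pD _] := sp.
by have := pD v (- v); rewrite subrr (sublinear0 sp); lra.
Qed.

(** Upper bounds for Zorn's lemma. The infimum is finite since [- p0 (- v)] is a lower bound, and
    subadditive because the smaller of two members of a chain can serve in both terms. *)
Lemma sublinear_inf_chain (p0 : V -> R) (A : set (V -> R)) :
  sublinear p0 -> A !=set0 ->
  (forall p, A p -> sublinear p /\ forall v, p v <= p0 v) ->
  (forall p q, A p -> A q ->
     (forall v, p v <= q v) \/ (forall v, q v <= p v)) ->
  let m v := inf [set p v | p in A] in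
  sublinear m /\ forall p, A p -> forall v, m v <= p v.
Proof.
move=> sp0 [a Aa] AS chainA m.
have lbA v : has_lbound [set p v | p in A].
  exists (- p0 (- v)) => _ [p Ap <-]; have [sp pp0] := AS _ Ap.
  by rewrite (le_trans _ (sublinear_geN v sp))// lerN2.
have mle p : A p -> forall v, m v <= p v.
  by move=> Ap v; apply: ge_inf => //; exists p.
have lem v x : (forall p, A p -> x <= p v) -> x <= m v.
  move=> xp; apply: lb_le_inf; first by exists (a v), a.
  by move=> _ [p Ap <-]; exact: xp.
split=> //; apply: sublinear_of_le => [u v||r v r0].
- rewrite -lerBlDr; apply: (lem u) => p Ap; rewrite lerBlDr -lerBlDl.
  apply: (lem v) => q Aq; rewrite lerBlDl.
  have [pq|qp] := chainA _ _ Ap Aq.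
    have [[pD _] _] := AS _ Ap.
    by rewrite (le_trans (mle _ Ap _))// (le_trans (pD _ _))// lerD2l.
  have [[qD _] _] := AS _ Aq.
  by rewrite (le_trans (mle _ Aq _))// (le_trans (qD _ _))// lerD2r.
- apply/le_anti; rewrite (le_trans (mle _ Aa _)) ?(sublinear0 (AS _ Aa).1)//=.
  by apply: (lem 0) => p Ap; rewrite (sublinear0 (AS _ Ap).1).
- rewrite mulrC -ler_pdivrMr//; apply: (lem v) => p Ap.
  rewrite ler_pdivrMr// mulrC -((AS _ Ap).1.2 _ _ (ltW r0)); exact: mle.
Qed.

(** A pair [(s, v)] in the cone stands for the demand [s <= f v] on the functional [f] sought. *)
Definition cone (C : set (R * V)) : Prop :=
  [/\ C (0, 0),
      forall c d, C c -> C d -> C (c.1 + d.1, c.2 + d.2) &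
      forall r c, 0 < r -> C c -> C (r * c.1, iota r *: c.2)].

(** [q] builds the demands of [C] into the bound: a linear [f <= q] has [f (- c.2) <= p 0 - c.1],
    that is [c.1 <= f c.2]. The hypothesis that [p] meets these demands keeps the infimum finite. *)
Lemma sublinear_inf_cone p C : sublinear p -> cone C ->
  (forall c, C c -> c.1 <= p c.2) ->
  let q v := inf [set p (v + c.2) - c.1 | c in C] in
  sublinear q /\ forall c v, C c -> q v <= p (v + c.2) - c.1.
Proof.
move=> sp [C0 CD CZ] Cp q; have [pD pZ] := sp.
have lbq v : lbound [set p (v + c.2) - c.1 | c in C] (- p (- v)).
  move=> _ [c Cc <-]; have := Cp _ Cc.
  by have := pD (v + c.2) (- v); rewrite addrAC subrr add0r; lra.
have qle c v : C c -> q v <= p (v + c.2) - c.1.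
  by move=> Cc; apply: ge_inf; [exists (- p (- v)); exact: lbq|exists c].
have leq v x : (forall c, C c -> x <= p (v + c.2) - c.1) -> x <= q v.
  move=> xp; apply: lb_le_inf; first by exists (p (v + 0) - 0), (0, 0).
  by move=> _ [c Cc <-]; exact: xp.
split=> //; apply: sublinear_of_le => [u v||r v r0].
- rewrite -lerBlDr; apply: (leq u) => c Cc; rewrite lerBlDr -lerBlDl.
  apply: (leq v) => d Cd; rewrite lerBlDl.
  rewrite (le_trans (qle _ _ (CD _ _ Cc Cd)))//=.
  by rewrite addrACA; have := pD (u + c.2) (v + d.2); lra.
- apply/le_anti/andP; split.
    by rewrite (le_trans (qle _ _ C0))//= addr0 subr0 (sublinear0 sp).
  by apply: (leq 0) => c Cc; rewrite add0r subr_ge0; exact: Cp.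
- rewrite mulrC -ler_pdivrMr//; apply: (leq v) => c Cc; rewrite ler_pdivrMr//.
  rewrite (le_trans (qle _ _ (CZ _ _ r0 Cc)))//=.
  by rewrite -scalerDr (pZ _ _ (ltW r0)); lra.
Qed.

(* A pointwise minimal sublinear [p] is additive: for every [v], the map
   [u |-> inf_(t >= 0) (p (u + t v) - t p v)] is sublinear and below [p], hence
   equal to [p], so that [p u <= p (u + v) - p v]. *)
Lemma hahn_banach (p0 : V -> R) : sublinear p0 ->
  exists2 f, real_linear f & forall v, f v <= p0 v.
Proof.
move=> sp0.
pose T := {p : V -> R | sublinear p /\ forall v, p v <= p0 v}.
(* The order is reversed, so that Zorn's lemma yields a pointwise minimal functional. *)
pose below (s t : T) := `[< forall v, sval t v <= sval s v >].
have [||||[p [sp pp0]] pmin] := @Zorn T below.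
- by move=> s; apply/asboolP.
- move=> r s t /asboolP rs /asboolP st; apply/asboolP => v.
  exact: le_trans (st v) (rs v).
- move=> [s hs] [t ht] /asboolP/= st /asboolP/= ts.
  by apply: eq_exist; apply/funext => v; apply/le_anti; rewrite st ts.
- move=> A chainA; have [->|/set0P[a Aa]] := eqVneq A set0.
    by exists (exist _ p0 (conj sp0 (fun=> lexx _))) => s.
  have [|||sm mle] := @sublinear_inf_chain p0 [set sval s | s in A] sp0.
  + by exists (sval a), a.
  + by move=> _ [s _ <-]; exact: (svalP s).
  + by move=> _ _ [s As <-] [t At <-];
      have [/asboolP|/asboolP] := chainA _ _ As At; [right|left].
  pose m v := inf [set p v | p in [set sval s | s in A]].
  have mp0 v : m v <= p0 v.
    by rewrite (le_trans (mle (sval a) _ v)) ?(svalP a).2//; exists a.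
  exists (exist _ m (conj sm mp0)) => s As; apply/asboolP => v /=.
  by apply: mle; exists s.
have [pD pZ] := sp.
have padd u v : p (u + v) = p u + p v.
  apply/le_anti; rewrite pD/=.
  pose C : set (R * V) := [set (t * p v, iota t *: v) | t in [set t | 0 <= t]].
  have Ct t : 0 <= t -> C (t * p v, iota t *: v) by move=> t0; exists t.
  have C0 : C (0, 0) by have := Ct 0 (lexx 0); rewrite mul0r rmorph0 scale0r.
  have cC : cone C.
    split=> // [_ _ [s /= s0 <-] [t /= t0 <-]|r _ r0 [t /= t0 <-]] /=.
      by rewrite -mulrDl -scalerDl -rmorphD; apply: Ct; rewrite addr_ge0.
    by rewrite mulrA scalerA -rmorphM; apply: Ct; rewrite mulr_ge0// ltW.
  have [|sq qle] := sublinear_inf_cone sp cC.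
    by move=> _ [t t0 <-] /=; rewrite pZ.
  set q := (fun w => inf _) in sq qle.
  have qp w : q w <= p w.
    by rewrite (le_trans (qle _ w C0))//= addr0 subr0.
  have qp0 w : q w <= p0 w by rewrite (le_trans (qp w)).
  have qpE : q = p.
    suff : exist _ q (conj sq qp0) = exist _ p (conj sp pp0) :> T by case.
    by apply: pmin; apply/asboolP.
  have : q u <= _ := qle _ u (Ct 1 ler01).
  by rewrite qpE/= rmorph1 scale1r mul1r; lra.
(* Additivity makes [p] odd, which extends homogeneity to negative scalars. *)
have pN v : p (- v) = - p v.
  by apply/eqP; rewrite -addr_eq0 -padd addNr (sublinear0 sp).
exists p; last exact: pp0.
split; first exact: padd.
move=> r v; have [r0|r0] := leP 0 r; first exact: pZ.
have r0' : 0 <= - r by rewrite oppr_ge0 ltW.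
by rewrite -[in LHS](opprK r) rmorphN scaleNr pN pZ// mulNr opprK.
Qed.

Lemma hahn_banach_cone p C : sublinear p -> cone C ->
  (forall c, C c -> c.1 <= p c.2) ->
  exists f, [/\ real_linear f, forall v, f v <= p v &
                 forall c, C c -> c.1 <= f c.2].
Proof.
move=> sp cC Cp; have [sq qle] := sublinear_inf_cone sp cC Cp.
have [f [fD fZ] fq] := hahn_banach sq.
have f0 : f 0 = 0 by have := fD 0 0; rewrite addr0; lra.
exists f; split=> // [v|c Cc].
  have [C0 _ _] := cC.
  by rewrite (le_trans (fq v))// (le_trans (qle _ v C0))//= addr0 subr0.
have := le_trans (fq (- c.2)) (qle _ (- c.2) Cc).
by rewrite addNr (sublinear0 sp); have := fD c.2 (- c.2); rewrite subrr f0; lra.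
Qed.

End hahn_banach.

(** * Block covering, limits of sets and counting *)

(* Greedy covering of an interval by short blocks of small sum; only the last
   block may be incomplete, whence the error term [N * M]. *)
Lemma sum_le_of_short_blocks (R : realType) (u : nat -> R) (M e : R) (N : nat) :
  0 <= M -> 0 <= e -> (forall k, u k <= M) ->
  forall a s,
  (forall m, (a <= m)%N -> exists n, [/\ (0 < n)%N, (n <= N)%N &
    \sum_(k < n) u (m + k)%N <= e * n%:R]) ->
  \sum_(k < s) u (a + k)%N <= e * s%:R + N%:R * M.
Proof.
move=> M0 e0 uM a s; elim/ltn_ind: s a => s IH a blk.
have [sN|Ns] := leqP s N.
  have : \sum_(k < s) u (a + k)%N <= s%:R * M.
    rewrite -[s in s%:R]card_ord mulr_natl -sumr_const.
    by apply: ler_sum => k _.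
  have : s%:R * M <= N%:R * M by rewrite ler_wpM2r// ler_nat.
  have : 0 <= e * s%:R by rewrite mulr_ge0.
  lra.
have [n [n0 nN le1]] := blk a (leqnn a).
have [t st] : exists t, s = (n + t)%N by exists (s - n)%N; lia.
have le2 : \sum_(k < t) u (a + n + k)%N <= e * t%:R + N%:R * M.
  by apply: IH => [|m am]; [lia|apply: blk; lia].
rewrite st big_split_ord/= natrD.
under [X in _ + X <= _]eq_bigr do rewrite addnA.
move: le2 le1; set S1 := \sum_(_ < _) _; set S2 := \sum_(_ < _) _; lra.
Qed.

(** Compactness of the space of 0-1 sequences: an ultrafilter finer than [\oo] decides each [A N k],
    and finitely many decisions hold together for arbitrarily large [N]. *)
Lemma eventually_equal_subsequence (A : nat -> nat -> bool) :
  exists B : nat -> bool, forall n : nat, exists2 N : nat, (n <= N)%N &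
    forall k, (k < n)%N -> B k = A N k.
Proof.
have [U [UU oU]] := ultraFilterLemma (eventually_filter : ProperFilter \oo).
pose B k := `[< U [set N | A N k] >].
exists B => n.
have UB k : U [set N | B k = A N k].
  rewrite /B; case: asboolP => [UA|UnA].
    by apply: filterS UA => N /= ->.
  have [//|UC] := in_ultra_setVsetC [set N | A N k] UU.
  by apply: filterS UC => N /= /negP/negbTE ->.
have Un : U [set N | forall k, (k < n)%N -> B k = A N k].
  elim: n => [|n IH]; first exact: filterS filterT.
  apply: filterS (filterI IH (UB n)) => N /= [h hn] k.
  by rewrite ltnS leq_eqVlt => /predU1P[->//|/h].
have Uge : U [set N | (n <= N)%N] by apply: oU; exists n.
by have [N [nN NB]] := filter_ex (filterI Uge Un); exists N.
Qed.

(** If no start [m] worked, a block of length at most [N] and mean at most [d / 2] would begin at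
    every [m >= a]; covering the window by such blocks would make its sum too small. *)
Lemma window_of_large_initial_means (R : realType) (M d : R) (N : nat) :
  0 <= M -> 0 < d ->
  exists L : nat, forall (u : nat -> R) (a b : nat), (forall k, u k <= M) ->
    (a + L <= b)%N -> d * (b.+1 - a)%:R < \sum_(a <= k < b.+1) u k ->
  exists2 m, (a <= m)%N &
    forall n, (n <= N)%N -> d / 2 * n%:R <= \sum_(k < n) u (m + k)%N.
Proof.
move=> M0 d0; have d20 : 0 < d / 2 by rewrite divr_gt0.
(* [L] makes the error [N * M] of the incomplete last block at most [d / 2] times the window
   length. *)
have [L LM] : exists L : nat, N%:R * M <= d / 2 * L%:R.
  exists (Num.bound (N%:R * M / (d / 2))).
  rewrite [leRHS]mulrC -ler_pdivrMr//.
  by apply/ltW/archi_boundP; rewrite divr_ge0 ?mulr_ge0// ltW.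
exists L => u a b uM ab large; apply: contrapT => noWindow.
have blk m : (a <= m)%N -> exists n, [/\ (0 < n)%N, (n <= N)%N &
    \sum_(k < n) u (m + k)%N <= d / 2 * n%:R].
  move=> am; apply: contrapT => noBlock; apply: noWindow; exists m => // n nN.
  have [->|n0] := posnP n; first by rewrite big_ord0 mulr0.
  by rewrite leNgt; apply/negP => /ltW small; apply: noBlock; exists n.
have := sum_le_of_short_blocks M0 (ltW d20) uM (b.+1 - a)%N blk.
have -> : \sum_(k < b.+1 - a) u (a + k)%N = \sum_(a <= k < b.+1) u k.
  rewrite -[in RHS](add0n a) big_addn big_mkord.
  by apply: eq_bigr => k _; rewrite addnC.
have : d / 2 * L%:R <= d / 2 * (b.+1 - a)%:R.
  by rewrite ler_pM2l// ler_nat; lia.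
by move: large LM; set S := \sum_(_ <= _ < _) _; lra.
Qed.

(** Terms with [c <= v k] are bounded by [M], the others by [c]; a large sum thus forces many large
    terms. *)
Lemma sum_le_count (R : realType) (v : nat -> R) (M c : R) n :
  0 <= M -> 0 <= c -> (forall k, v k <= M) ->
  \sum_(k < n) v k <= M * \sum_(k < n) (c <= v k)%R%:R + c * n%:R.
Proof.
move=> M0 c0 vM.
rewrite -[n in n%:R]card_ord mulr_natr -sumr_const mulr_sumr -big_split/=.
apply: ler_sum => k _; have [_|/ltW vc] := leP c (v k).
  by rewrite mulr1 (le_trans (vM k))// lerDl.
by rewrite mulr0 add0r.
Qed.

(** * Real parts of functionals over both scalar fields *)

(* Treats [K = R] and [K = R[i]] at once: [iota] embeds the reals into the
   scalars, and [w] is the imaginary unit, or [0] when [K = R]. *)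
Record real_part_axioms (R : realType) (K : numFieldType)
    (iota : {rmorphism R -> K}) (re : K -> R) (w : K) : Prop := RealPart {
  reD : forall y z, re (y + z) = re y + re z;
  reZ : forall r z, re (iota r * z) = r * re z;
  re1 : re 1 = 1;
  re_ge0 : forall z, 0 <= z -> 0 <= re z;
  ge0_reK : forall z, 0 <= z -> iota (re z) = z;
  iota_ge0 : forall r, 0 <= r -> 0 <= iota r;
  le_norm_re : forall z, `|re z| <= re `|z|;
  w0_or_sqrN1 : w = 0 \/ w * w = -1;
  re_w : re w = 0;
  re_decomposition : forall z, z = iota (re z) - w * iota (re (w * z)) }.

Section real_part.
Variables (R : realType) (K : numFieldType) (iota : {rmorphism R -> K}).
Variables (re : K -> R) (w : K).
Hypothesis HK : real_part_axioms iota re w.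

Let reD := reD HK.
Let reZ := reZ HK.

Lemma re_le y z : y <= z -> re y <= re z.
Proof.
move=> yz; rewrite -(subrK y z) reD lerDr; apply: (re_ge0 HK).
by rewrite subr_ge0.
Qed.

Lemma norm_w_le1 : `|w| <= 1.
Proof.
have [->|w2] := w0_or_sqrN1 HK; first by rewrite normr0.
by rewrite -(@expr_le1 _ 2)// -normrX expr2 w2 normrN1.
Qed.

Lemma re_iota r : re (iota r) = r.
Proof. by rewrite -[iota r]mulr1 reZ (re1 HK) mulr1. Qed.

Lemma iotaK_norm (Y : normedModType K) (v : Y) : iota (re `|v|) = `|v|.
Proof. exact: (ge0_reK HK). Qed.

Variable X : normedModType K.
Implicit Types (h : X -> R) (v : X).

Definition real_norm v : R := re `|v|.

Lemma real_norm_ge0 v : 0 <= real_norm v.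
Proof. exact: (re_ge0 HK). Qed.

Lemma real_normN v : real_norm (- v) = real_norm v.
Proof. by rewrite /real_norm normrN. Qed.

Lemma real_norm_sublinear : sublinear iota real_norm.
Proof.
split=> [u v|r v r0]; first by rewrite /real_norm -reD; exact/re_le/ler_normD.
by rewrite /real_norm normrZ ger0_norm ?reZ//; exact: (iota_ge0 HK).
Qed.

Lemma real_norm_w v : real_norm (w *: v) <= real_norm v.
Proof.
apply: re_le; rewrite normrZ -[leRHS]mul1r ler_wpM2r//; exact: norm_w_le1.
Qed.

(** Over the complex numbers [re (w * z)] is minus the imaginary part of [z]. *)
Lemma norm_le_re (z : K) : re `|z| <= `|re z| + `|re (w * z)|.
Proof.
have iota_norm (r : R) : re `|iota r| = `|r|.
  have ge0 (s : R) : 0 <= s -> re `|iota s| = s.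
    by move=> s0; rewrite ger0_norm ?re_iota//; exact: (iota_ge0 HK).
  have [r0|r0] := ger0P r; first exact: ge0.
  by rewrite -normrN -rmorphN ge0// oppr_ge0 ltW.
rewrite {1}(re_decomposition HK z) -iota_norm -(iota_norm (re (w * z))) -reD.
apply: re_le; rewrite (le_trans (ler_normB _ _))// lerD2l normrM.
by rewrite -[leRHS]mul1r ler_wpM2r//; exact: norm_w_le1.
Qed.

Lemma real_linear_re (f : {linear X -> K^o}) (a : K) :
  real_linear iota (fun v => re (a * f v)).
Proof.
split=> [u v|r v]; first by rewrite linearD mulrDr reD.
by rewrite linearZ/= -reZ mulrCA.
Qed.

Lemma real_linear_sum h n (l : nat -> R) (y : nat -> X) : real_linear iota h ->
  h (\sum_(k < n) iota (l k) *: y k) = \sum_(k < n) l k * h (y k).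
Proof.
move=> [hD hZ]; have h0 : h 0 = 0 by have := hD 0 0; rewrite addr0; lra.
elim: n => [|n IH]; first by rewrite !big_ord0.
by rewrite !big_ord_recr/= hD hZ IH.
Qed.

Lemma real_linear_abs_le h v : real_linear iota h ->
  (forall u, h u <= real_norm u) -> `|h v| <= real_norm v.
Proof.
move=> [hD hZ] hN; rewrite ler_norml hN andbT lerNl -real_normN.
suff <- : h (- v) = - h v by exact: hN.
by rewrite -scaleN1r -(rmorphN1 iota) hZ mulN1r.
Qed.

(** The classical formula [g v = h v - i h (i v)] recovers a complex functional from its real part;
    with [w = 0] it is just [h]. *)
Lemma complexification h :
  real_linear iota h -> (forall v, h v <= real_norm v) ->
  exists2 g : {linear X -> K^o}, dual g & forall v, re (g v) = h v.
Proof.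
move=> lh hN; have [hD hZ] := lh.
pose g v : K := iota (h v) - w * iota (h (w *: v)).
have gD u v : g (u + v) = g u + g v.
  by rewrite /g scalerDr !hD !rmorphD; ring.
have giota r v : g (iota r *: v) = iota r * g v.
  by rewrite /g scalerA (mulrC w (iota r)) -scalerA !hZ !rmorphM; ring.
have gw v : g (w *: v) = w * g v.
  rewrite /g scalerA; have [->|w2] := w0_or_sqrN1 HK.
    by rewrite mul0r !scale0r (_ : h 0 = 0) ?rmorph0 ?mul0r ?subr0//;
      have := hD 0 0; rewrite addr0; lra.
  rewrite w2 -(rmorphN1 iota) hZ mulN1r rmorphN mulrBr mulrA w2; ring.
have gN v : g (- v) = - g v.
  by rewrite -scaleN1r -(rmorphN1 iota) giota rmorphN1 mulN1r.
have gZ : scalable (g : X -> K^o).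
  move=> a v; rewrite {1}(re_decomposition HK a) scalerBl gD gN -scalerA gw.
  by rewrite !giota [in RHS](re_decomposition HK a) [RHS]mulrBl mulrA.
have gB : additive (g : X -> K^o) by move=> u v; rewrite gD gN.
pose G : {linear X -> K^o} := HB.pack g
  (GRing.isAdditive.Build _ _ g gB) (GRing.isScalable.Build _ _ _ _ g gZ).
have reG v : re (G v) = h v.
  rewrite /G/= /g reD re_iota mulrC -mulNr -rmorphN reZ (re_w HK) mulr0.
  by rewrite addr0.
exists G => //; apply/linear_bounded_continuous/linear_boundedP.
near=> r => v; rewrite -(iotaK_norm v) -(iotaK_norm (G v : K^o)).
(* The crude constant 2 comes from bounding both parts of [g v] by the norm, which is enough for
   continuity. *)
apply: (@le_trans _ _ (2 * iota (re `|v|))); last first.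
  rewrite ler_wpM2r// ?iotaK_norm//; near: r; exact: nbhs_pinfty_ge.
rewrite -[2](rmorph_nat iota) -rmorphM -subr_ge0 -rmorphB.
apply: (iota_ge0 HK); rewrite subr_ge0 (le_trans (norm_le_re _))//.
have -> : w * G v = G (w *: v) by rewrite linearZ.
rewrite !reG; have := real_linear_abs_le v lh hN.
have := real_linear_abs_le (w *: v) lh hN; have := real_norm_w v.
rewrite /real_norm; lra.
Unshelve. all: by end_near. Qed.

End real_part.

(** * Mixing conditions for convex shift-bounded sequences *)

Section mixing.
Variables (R : realType) (K : numFieldType) (iota : {rmorphism R -> K}).
Variables (re : K -> R) (w : K).
Hypothesis HK : real_part_axioms iota re w.
Variable X : normedModType K.
Implicit Types (h : X -> R) (v : X) (x : nat -> X).

Local Notation rnorm := (@real_norm R K re X).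

(** By hypothesis the norm meets the demands of the cone generated by the pairs [(eta, y k)] with
    [k] in [B], so Hahn-Banach provides one functional for all of them. *)
Lemma functional_ge_on (y : nat -> X) (B : nat -> bool) (eta : R) :
  (forall n (l : nat -> R), (forall k, 0 <= l k) ->
     (forall k, ~~ B k -> l k = 0) ->
     eta * \sum_(k < n) l k <= rnorm (\sum_(k < n) iota (l k) *: y k)) ->
  exists h, [/\ real_linear iota h, forall v, h v <= rnorm v &
                forall k, B k -> eta <= h (y k)].
Proof.
move=> etaB.
(* Finite combinations are expressed by partial sums that are constant from [p] on, so that two of
   them can be added without matching their lengths. *)
pose C : set (R * X) := [set c | exists p l, [/\ forall k, 0 <= l k,
  forall k, ~~ B k -> l k = 0 & forall n, (p <= n)%N ->
    c = (eta * \sum_(k < n) l k, \sum_(k < n) iota (l k) *: y k)]].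
have cC : cone iota C.
  split=> [|c d [p [l [l0 lB lc]]] [q [m [m0 mB md]]]|
           r c r0 [p [l [l0 lB lc]]]].
  - exists 0%N, (fun=> 0); split=> // n _.
    by rewrite !big1 ?mulr0// => k _; rewrite rmorph0 scale0r.
  - exists (maxn p q), (fun k => l k + m k); split=> [k|k Bk|n].
    + by rewrite addr_ge0.
    + by rewrite lB// mB// addr0.
    + rewrite geq_max => /andP[/lc -> /md ->] /=; rewrite -mulrDr -!big_split/=.
      congr pair; apply: eq_bigr => k _.
      by rewrite rmorphD scalerDl.
  - exists p, (fun k => r * l k); split=> [k|k Bk|n /lc -> /=].
    + by rewrite mulr_ge0// ltW.
    + by rewrite lB// mulr0.
    + rewrite mulrCA !mulr_sumr scaler_sumr; congr pair.
      by apply: eq_bigr => k _; rewrite rmorphM scalerA.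
have [c [p [l [l0 lB /(_ p (leqnn p)) ->]]]|h [lh hN hC]] :=
  hahn_banach_cone (real_norm_sublinear HK X) cC; first exact: etaB.
exists h; split=> // k Bk.
suff /hC : C (eta, y k) by [].
exists k.+1, (fun j => (j == k)%:R); split=> // [j|n kn].
  by move=> Bj; rewrite (_ : j == k = false)//; apply: contraNF Bj => /eqP ->.
rewrite (bigD1 (Ordinal kn))//= eqxx big1 => [|j]; last first.
  by rewrite -val_eqE/= => /negbTE ->.
rewrite (bigD1 (Ordinal kn))//= eqxx big1 => [|j]; last first.
  by rewrite -val_eqE/= => /negbTE ->; rewrite rmorph0 scale0r.
by rewrite mulr1n rmorph1 scale1r !addr0 mulr1.
Qed.

Lemma convex_shift_bounded_real x : convex_shift_bounded x ->
  exists2 C : R, 0 < C & forall n (l : nat -> R) m, (1 <= m)%N ->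
    (forall k, 0 <= l k) ->
    rnorm (\sum_(k < n) iota (l k) *: x (m + k)%N) <=
    C * rnorm (\sum_(k < n) iota (l k) *: x k.+1).
Proof.
move=> [c c0 xc]; have rc0 := re_ge0 HK (ltW c0).
(* The added 1 makes the constant positive and covers [m = 1], the unshifted sequence, whereas the
   definition speaks of shifts by at least 1. *)
exists (re c + 1) => [|n l m m1 l0]; first lra.
have N0 := real_norm_ge0 HK (\sum_(k < n) iota (l k) *: x k.+1).
case: n => [|n] in N0 *.
  rewrite !big_ord0 /real_norm normr0 -(rmorph0 iota) (re_iota HK).
  by rewrite mulr0.
case: m m1 => // -[|m] _.
  under eq_bigr do rewrite add1n.
  by rewrite mulrDl mul1r lerDr mulr_ge0.
have := xc n.+1 (fun j => iota (l j.-1)) m.+1 isT isT.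
rewrite !big_add1/= !big_mkord => /(_ (fun _ _ => iota_ge0 HK (l0 _))).
under eq_bigr do rewrite addSnnS addnC.
move=> /(re_le HK); rewrite -[c in re (c * _)](ge0_reK HK (ltW c0)) (reZ HK).
by rewrite -!/(rnorm _); lra.
Qed.

(** Positive parts are summed so that a large mean forces [h] itself, with its sign, to be large at
    many places; convex combinations preserve such one-sided bounds. *)
Lemma uniform_real x : convex_shift_bounded x -> weakly_mixing_to_zero re x ->
  forall e : R, 0 < e -> exists L : nat, forall a b h, (1 <= a)%N ->
    (a + L <= b)%N -> real_linear iota h -> (forall v, h v <= rnorm v) ->
    \sum_(a <= k < b.+1) Num.max (h (x k)) 0 <= e * (b.+1 - a)%:R.
Proof.
move=> csb wm e e0; apply: contrapT => noL.
have [C C0 xC] := convex_shift_bounded_real csb.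
(* The first summand bounds the norms from index 1 on, the arbitrary [x 0] gets its own, and 1 makes
   [M] positive. *)
pose M := C * rnorm (x 1%N) + rnorm (x 0%N) + 1.
have N0 k := real_norm_ge0 HK (x k).
have CN0 : 0 <= C * rnorm (x 1%N) by rewrite mulr_ge0// ltW.
have M0 : 0 < M by have := N0 0%N; rewrite /M; lra.
have xM k : rnorm (x k) <= M.
  case: k => [|k]; first by rewrite /M; lra.
  have := xC 1%N (fun=> 1) k.+1 isT (fun=> ler01).
  by rewrite !big_ord1 rmorph1 !scale1r addn0; have := N0 0%N; rewrite /M; lra.
have wnd N : exists mh : nat * (X -> R), [/\ (1 <= mh.1)%N,
    real_linear iota mh.2, forall v, mh.2 v <= rnorm v &
    forall n, (n <= N)%N ->
      e / 2 * n%:R <= \sum_(k < n) Num.max (mh.2 (x (mh.1 + k)%N)) 0].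
  have [L winL] := window_of_large_initial_means N (ltW M0) e0.
  apply: contrapT => noN; apply: noL; exists L => a b h a1 ab lh hN.
  rewrite leNgt; apply/negP => large; apply: noN.
  have [|m am mN] := winL (fun k => Num.max (h (x k)) 0) a b _ ab large.
    by move=> k; rewrite ge_max (ltW M0) andbT (le_trans (hN _)).
  by exists (m, h); split => //=; exact: leq_trans am.
have /choice[mh mhP] := wnd.
(* The threshold is half of the guaranteed mean [e / 2]: smaller terms contribute at most half of
   it, so the large ones have proportion at least [e / 4 / M]. *)
pose A N k := e / 4 <= Num.max ((mh N).2 (x ((mh N).1 + k)%N)) 0.
have hA N k : A N k -> e / 4 <= (mh N).2 (x ((mh N).1 + k)%N).
  by rewrite /A le_max => /orP[//|]; lra.
have e4 : 0 < e / 4 by lra.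
have countA N n : (n <= N)%N -> e / 4 * n%:R <= M * \sum_(k < n) (A N k)%:R.
  move=> nN; have [_ _ hN /(_ n nN) le1] := mhP N.
  have hM k : Num.max ((mh N).2 (x ((mh N).1 + k)%N)) 0 <= M.
    by rewrite ge_max (ltW M0) andbT (le_trans (hN _)).
  have := sum_le_count n (ltW M0) (ltW e4) hM; rewrite -/(A N _).
  by move: le1; set S := \sum_(_ < _) _; set T := \sum_(_ < _) _; lra.
have [B BA] := eventually_equal_subsequence A.
have countB n : e / 4 * n%:R <= M * \sum_(k < n) (B k)%:R.
  have [N nN NB] := BA n; rewrite (le_trans (countA _ _ nN))//.
  by under [X in _ <= _ * X]eq_bigr do rewrite NB//.
(* Dividing by [C] pays for shifting a combination from the window of [A N] back to the start of the
   sequence. *)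
pose eta := e / 4 / C.
have eta0 : 0 < eta by rewrite divr_gt0.
have [n l l0 lB|f [lf fN fB]] := @functional_ge_on (x \o S) B eta.
  (* [B] agrees with some [A N] below [n], so the single functional [(mh N).2] is at least [e / 4]
     wherever [l] puts weight. *)
  have [N nN NB] := BA n; have [m1 lh hN _] := mhP N.
  rewrite /eta mulrAC ler_pdivrMr// [leRHS]mulrC.
  rewrite (le_trans _ (xC _ _ _ m1 l0))// (le_trans _ (hN _))//.
  rewrite (real_linear_sum _ l (fun k => x (_ + k)%N) lh) mulr_sumr.
  apply: ler_sum => k _.
  have [Bk|/lB ->] := boolP (B k); last by rewrite mulr0 mul0r.
  by rewrite mulrC ler_wpM2l// hA// -NB.
have [g dg gf] := complexification HK lf fN.
(* A lower bound for the means of [g]: its real part is at least [eta] on [B], whose proportion is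
   at least [e / 4 / M]. *)
have delta0 : 0 < eta * (e / 4 / M) by rewrite mulr_gt0// divr_gt0.
have /cvgr_lt/(_ _ delta0)[n0 _ /(_ n0.+1 (leqnSn _))] := wm _ dg.
rewrite /= /mean_abs subn1/= big_add1/= big_mkord.
rewrite ltNge => /negP; apply.
rewrite ler_pdivlMl//.
apply: (@le_trans _ _ (eta * \sum_(k < n0.+1) (B k)%:R)).
  rewrite mulrCA ler_pM2l// mulrCA mulrA ler_pdivrMr// [leRHS]mulrC.
  exact: countB.
rewrite mulr_sumr; apply: ler_sum => k _.
rewrite (le_trans _ (le_norm_re HK _))// gf.
have [/fB Bk|_] := boolP (B k); last by rewrite mulr0.
by rewrite mulr1 (le_trans Bk)// ler_norm.
Qed.

Lemma dual_ball_le (f : {linear X -> K^o}) v : dual_ball re f ->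
  re `|f v| <= rnorm v.
Proof.
move=> [_ f1].
have [->|v0] := eqVneq v 0; first by rewrite linear0 /real_norm !normr0.
have Nv : `|v| = iota (rnorm v) by rewrite (iotaK_norm HK).
have t0 : 0 < rnorm v.
  rewrite lt_def (real_norm_ge0 HK) andbT; apply: contraNneq v0 => N0.
  by rewrite -normr_eq0 Nv N0 rmorph0.
have ti0 : 0 <= iota (rnorm v)^-1 by apply: (iota_ge0 HK); rewrite invr_ge0 ltW.
pose u := iota (rnorm v)^-1 *: v.
have u1 : `|u| <= 1.
  by rewrite normrZ (ger0_norm ti0) Nv -rmorphM mulVf ?gt_eqF// rmorph1.
have : ((re `|f u|)%:E <= 1)%E.
  by apply: le_trans f1; apply: ereal_sup_ubound; exists u.
rewrite lee_fin /u linearZ/= normrM (ger0_norm ti0) (reZ HK).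
by rewrite ler_pdivrMl// mulr1.
Qed.

(** The modulus of [z] is at most the sum of the positive parts of the real parts of [z], [- z],
    [w * z] and [- w * z]; each comes from a real functional below the norm and receives a quarter
    of [e]. *)
Lemma uniform_means x : convex_shift_bounded x -> weakly_mixing_to_zero re x ->
  forall e : R, 0 < e -> exists L : nat, forall a b, (1 <= a)%N ->
    (a + L <= b)%N -> forall f, dual_ball re f -> mean_abs re x f a b <= e.
Proof.
move=> csb wm e e0; have e4 : 0 < e / 4 by lra.
have [L HL] := uniform_real csb wm e4; exists L => a b a1 ab f f1.
have n0 : 0 < (b.+1 - a)%:R :> R by rewrite ltr0n; lia.
rewrite /mean_abs ler_pdivrMl//.
have part (c : K) : `|c| <= 1 ->
    \sum_(a <= k < b.+1) Num.max (re (c * f (x k))) 0 <= e / 4 * (b.+1 - a)%:R.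
  move=> c1; apply: (HL a b (fun v => re (c * f v))) => //.
    exact: (real_linear_re HK).
  move=> v; rewrite (le_trans (ler_norm _))// (le_trans (le_norm_re HK _))//.
  rewrite (le_trans _ (dual_ball_le v f1))//; apply: (re_le HK).
  by rewrite normrM -[leRHS]mul1r ler_wpM2r.
have := part 1; have := part (-1); have := part w; have := part (- w).
rewrite !normrN normr1 => /(_ (norm_w_le1 HK)) p1 /(_ (norm_w_le1 HK)) p2.
move=> /(_ (lexx _)) p3 /(_ (lexx _)) p4.
apply: (@le_trans _ _ (\sum_(a <= k < b.+1) (Num.max (re (- w * f (x k))) 0 +
    Num.max (re (w * f (x k))) 0 + Num.max (re (-1 * f (x k))) 0 +
    Num.max (re (1 * f (x k))) 0))); last by rewrite !big_split/=; lra.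
apply: ler_sum => k _; rewrite (le_trans (norm_le_re HK _))//.
have reN z : re (- z) = - re z.
  by rewrite -mulN1r -(rmorphN1 iota) (reZ HK) mulN1r.
have normE (r : R) : `|r| = Num.max (- r) 0 + Num.max r 0.
  have [r0|/ltW r0] := ger0P r.
    by rewrite max_r ?add0r// oppr_le0.
  by rewrite max_l ?addr0// oppr_ge0.
by rewrite !mul1r !mulNr !mul1r !reN !normE; lra.
Qed.

Lemma dual_ball_of_le (f : {linear X -> K^o}) :
  (forall v, `|f v| <= `|v|) -> dual_ball re f.
Proof.
move=> f1; split.
  apply/linear_bounded_continuous/linear_boundedP.
  apply: filterS (nbhs_pinfty_ge (real1 K)) => r r1 v.
  by rewrite (le_trans (f1 v))// -[leLHS]mul1r ler_wpM2r.
apply: ge_ereal_sup => _ [v v1 <-]; rewrite lee_fin -(re1 HK).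
exact/(re_le HK)/(le_trans (f1 v)).
Qed.

Lemma sup_mean_abs_ge0 x a b : (0 <= sup_mean_abs re x a b)%E.
Proof.
apply: ereal_sup_ubound; exists (\0 : {linear X -> K^o}) => /=.
  by apply: dual_ball_of_le => v; rewrite normr0.
rewrite /mean_abs big1 ?mulr0// => k _.
by rewrite normr0 -(rmorph0 iota) (re_iota HK).
Qed.

Lemma windowed_of_means x :
  (forall e : R, 0 < e -> exists L : nat, forall a b, (1 <= a)%N ->
    (a + L <= b)%N -> forall f, dual_ball re f -> mean_abs re x f a b <= e) ->
  windowed_uniformly_weakly_mixing_to_zero re x.
Proof.
move=> means; apply/le_anti/andP; split; last first.
  apply: limf_esup_ge0 => [[N _ N0]|ab]; last exact: sup_mean_abs_ge0.
  (* This pair shows that the gap filter is proper, so the upper limit of nonnegative values is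
     nonnegative. *)
  by have : set0 (1%N, N.+1) by apply: N0 => /=; split=> //; lia.
apply/lee_addgt0Pr => e e0; rewrite add0e.
have [L HL] := means e e0.
rewrite limf_esupE; apply: le_trans (ereal_inf_lbound _) _.
  by exists [set ab | [/\ (1 <= ab.1)%N, (1 <= ab.2)%N &
                          (ab.1 + L <= ab.2)%N]] => //; exists L.
apply: ge_ereal_sup => _ [[a b] /= [a1 _ ab] <-].
apply: ge_ereal_sup => _ [f f1 <-]; rewrite lee_fin; exact: HL.
Qed.

(** The pairs [(1, n)] eventually enter every set of the gap filter. *)
Lemma uniformly_of_windowed x :
  windowed_uniformly_weakly_mixing_to_zero re x ->
  uniformly_weakly_mixing_to_zero re x.
Proof.
move=> wx; have small (e : R) : 0 < e ->
    \forall n \near \oo, (sup_mean_abs re x 1 n <= e%:E)%E.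
  move=> e0; have : (limf_esup
    (fun ab : nat * nat => sup_mean_abs re x ab.1 ab.2) gap_to_infinity
      < e%:E)%E by rewrite wx lte_fin.
  rewrite limf_esupE => /ereal_inf_lt[_ [V [N _ NV] <-] /ltW Ve].
  exists N.+1 => // n /= Nn; apply: le_trans Ve; apply: ereal_sup_ubound.
  by exists (1%N, n) => //; apply: NV; split=> //=; lia.
apply/fine_cvgP; split.
  near=> n; rewrite ge0_fin_numE ?sup_mean_abs_ge0//.
  apply: (@le_lt_trans _ _ 1%:E); last exact: ltry.
  near: n; exact: small.
apply/cvgrPdist_le => e e0; near=> n.
have n_e : (sup_mean_abs re x 1 n <= e%:E)%E by near: n; exact: small.
have n_fin : sup_mean_abs re x 1 n \is a fin_num.
  by rewrite ge0_fin_numE ?sup_mean_abs_ge0// (le_lt_trans n_e) ?ltry.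
rewrite sub0r normrN ger0_norm/= ?fine_ge0 ?sup_mean_abs_ge0//.
by rewrite -lee_fin fineK.
Unshelve. all: by end_near. Qed.

(** Dividing [f] by a bound [r] puts it in the dual ball; the factor [re r] is harmless in the
    limit. *)
Lemma weakly_of_uniformly x :
  uniformly_weakly_mixing_to_zero re x -> weakly_mixing_to_zero re x.
Proof.
move=> ux f /linear_bounded_continuous/linear_boundedP fB.
have [r [fr r0]] := filter_ex (filterI fB (nbhs_pinfty_gt (real0 K))).
have rE := ge0_reK HK (ltW r0).
have ri0 : 0 <= r^-1 by rewrite invr_ge0 ltW.
have rr0 := re_ge0 HK (ltW r0).
pose g : {linear X -> K^o} := r^-1 \*: f.
have gf v : re `|f v| = re r * re `|g v|.
  rewrite -(reZ HK) rE /g/= normrM (ger0_norm ri0) mulrA.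
  by rewrite mulfV ?mul1r// gt_eqF.
have g1 : dual_ball re g.
  apply: dual_ball_of_le => v; rewrite /g/= normrM (ger0_norm ri0).
  by rewrite ler_pdivrMl.
have mE n : mean_abs re x f 1 n = re r * mean_abs re x g 1 n.
  rewrite /mean_abs mulrCA [X in _ = _ * X]mulr_sumr; congr (_ * _).
  by apply: eq_bigr => k _; exact: gf.
have /fine_cvgP[uxfin ux0] := ux.
have ub : fine (sup_mean_abs re x 1 n) * re r @[n --> \oo] --> (0 : R).
  by rewrite -[0](mul0r (re r)); apply: cvgM ux0 (cvg_cst _).
apply: (squeeze_cvgr _ (cvg_cst 0) ub).
near=> n; rewrite mE; apply/andP; split.
  rewrite mulr_ge0// /mean_abs mulr_ge0// sumr_ge0// => k _.
  exact: (re_ge0 HK).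
rewrite mulrC /= ler_wpM2r// -lee_fin fineK; last by near: n.
by apply: ereal_sup_ubound; exists g.
Unshelve. all: by end_near. Qed.

Lemma mixing_equivalences x : convex_shift_bounded x ->
  (weakly_mixing_to_zero re x <-> uniformly_weakly_mixing_to_zero re x) /\
  (uniformly_weakly_mixing_to_zero re x <->
   windowed_uniformly_weakly_mixing_to_zero re x).
Proof.
move=> csb; have w2 := @weakly_of_uniformly x.
have u2 := @uniformly_of_windowed x.
have i3 wx := windowed_of_means (uniform_means csb wx).
by split; split=> //; auto.
Qed.

End mixing.

(** * The real and the complex scalar field *)

Lemma real_part_idfun (R : realType) :
  @real_part_axioms R R (@idfun R) (@idfun R) 0.
Proof.
by split=> //=; [left|move=> z; rewrite mul0r subr0].
Qed.

Lemma real_part_complex (R : realType) :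
  @real_part_axioms R R[i] (real_complex R) (@complex.Re R) 'i%C.
Proof.
split=> /=.
- by move=> [a b] [c d].
- by move=> r [a b] /=; rewrite mul0r subr0.
- by [].
- by move=> [a b]; rewrite lecE/= => /andP[].
- by move=> [a b]; rewrite lecE/= => /andP[/eqP-> _].
- by move=> r; rewrite ler0c.
- by move=> z; rewrite -lecR (le_trans (normc_ge_Re z))// normc_def.
- by right; rewrite -expr2 sqr_i.
- by [].
- by move=> z; rewrite (mulrC _ z) ReiNIm rmorphN mulrN opprK -complexE.
Qed.

Theorem theorem5p2 (R : realType) :
  (forall (X : completeNormedModType R) (x : nat -> X),
     convex_shift_bounded x ->
     (weakly_mixing_to_zero (@idfun R) x <->
      uniformly_weakly_mixing_to_zero (@idfun R) x) /\
     (uniformly_weakly_mixing_to_zero (@idfun R) x <->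
      windowed_uniformly_weakly_mixing_to_zero (@idfun R) x)) /\
  (forall (X : completeNormedModType R[i]) (x : nat -> X),
     convex_shift_bounded x ->
     (weakly_mixing_to_zero (@complex.Re R) x <->
      uniformly_weakly_mixing_to_zero (@complex.Re R) x) /\
     (uniformly_weakly_mixing_to_zero (@complex.Re R) x <->
      windowed_uniformly_weakly_mixing_to_zero (@complex.Re R) x)).
Proof.
split=> X x; first exact: (mixing_equivalences (real_part_idfun R)).
exact: (mixing_equivalences (real_part_complex R)).
Qed.
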